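(* Let $X_1,\ldots,X_n$ be independent continuous lifetimes, each $X_i$ having p.d.f. $f_i$ and c.d.f. $F_i$, with $F_i(0)=0$, and let $q$ be the associated relative quality function. Then for every nonempty $S\subseteq[n]$, $$ q(S)=\sum_{j\in S}\int_0^{\infty} f_j(t)\,\prod_{i\in [n]\setminus S}F_i(t)\,\prod_{i\in S\setminus\{j\}}(1-F_i(t))\,\mathrm{d}t. $$
   Context: Notation: $[n]=\{1,\ldots,n\}$; empty products equal $1$. The lifetimes are nonnegative random variables. The relative quality function associated with $X_1,\ldots,X_n$ is $q\colon 2^{[n]}\to[0,1]$ defined by $q(S)=\Pr\big(\max_{i\in[n]\setminus S}X_i<\min_{j\in S}X_j\big)$, with the convention $q(\varnothing)=q([n])=1$. *)

(* Defs.v *)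
From HB Require Import structures.
From mathcomp Require Import all_boot all_order all_algebra.
From mathcomp Require Import all_classical all_reals all_analysis.

Set Implicit Arguments.
Unset Strict Implicit.
Unset Printing Implicit Defensive.

Import Order.TTheory GRing.Theory Num.Theory.
Import numFieldNormedType.Exports.

Local Open Scope classical_set_scope.
Local Open Scope ring_scope.

Definition mutually_independent (d : measure_display) (T : measurableType d)
    (R : realType) (P : probability T R) (n : nat) (X : 'I_n -> {RV P >-> R}) :=
  forall (J : {set 'I_n}) (A : 'I_n -> set R),
    (forall i, i \in J -> measurable (A i)) ->
    P (\bigcap_(i in [set` J]) (X i @^-1` A i)) =
    (\prod_(i in J) P (X i @^-1` A i))%E.

Definition is_pdf (d : measure_display) (T : measurableType d)
    (R : realType) (P : probability T R) (X : {RV P >-> R}) (f : R -> R) :=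
  [/\ measurable_fun [set: R] f,
      forall x, 0 <= f x &
      forall A : set R, measurable A ->
        distribution P X A = (\int[lebesgue_measure]_(x in A) (f x)%:E)%E].

(* The maximum and the minimum are taken in \bar R only to have neutral
   elements for the iterated operators; in the last branch both range over
   nonempty index sets, so their values are the real maximum and minimum. *)
Definition relative_quality (d : measure_display) (T : measurableType d)
    (R : realType) (P : probability T R) (n : nat) (X : 'I_n -> {RV P >-> R})
    (S : {set 'I_n}) : R :=
  if (S == finset.set0) || (S == finset.setT) then 1
  else fine (P [set w | (\big[maxe/-oo]_(i in ~: S) (X i w)%:E <
                         \big[mine/+oo]_(j in S) (X j w)%:E)%E]).

(* Main.v *)
Require Import Defs.
From HB Require Import structures.
From mathcomp Require Import all_boot all_order all_algebra.
From mathcomp Require Import all_classical all_reals all_analysis.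
From mathcomp Require Import measurable_realfun.

Set Implicit Arguments.
Unset Strict Implicit.
Unset Printing Implicit Defensive.

Import Order.TTheory GRing.Theory Num.Theory.
Import numFieldNormedType.Exports.

Local Open Scope classical_set_scope.
Local Open Scope ring_scope.

(** The event that every lifetime outside [S] ends before every lifetime in [S]
is cut according to which [j] in [S] ends first; given that the first one is
[j] and that it ends at time [t], the other lifetimes must fall on prescribed
sides of [t], and independence turns the probability of this into a product of
values [F i t] and [1 - F i t].  Integrating against the density of [X j] gives
the [j]-th summand.

Two points need care.

Ties.  Breaking ties by index makes the pieces an exact partition
([separated_eq_bigcup], [trivIset_first_argmin]): [j] is the least index at
which the minimum over [S] is reached.  Some of the inequalities against [t]
are then weak, but a law with a density has no atoms, so weak and strict ones
have the same probability ([pdf_prob_ge]).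

Conditioning on [X j].  Independence is a product rule for finitely many
preimages, while the event compares [X j] with all the other lifetimes at once.
Such preimages of the other lifetimes form a pi-system, so the product rule
extends to the sigma-algebra they generate ([indep_sigma_algebra]).  With the
sample space itself carrying that sigma-algebra as second factor, the law of
the pair formed by [X j] and the identity is a product measure, and Tonelli's
theorem lets the value of [X j] be frozen ([freezing_pdf]).
[joint_event_integral] combines the two. *)

(** * Freezing one of two independent variables *)

(** Both sides are finite measures in [E] that agree on the pi-system [G], and
[G] contains the whole space, hence they agree on the generated
sigma-algebra. *)
Lemma indep_sigma_algebra (d : measure_display) (T : measurableType d)
    (R : realType) (P : probability T R) (G : set (set T)) (D : set T) :
  G `<=` measurable -> setI_closed G -> G setT -> measurable D ->
  (forall E, G E -> P (E `&` D) = (P D * P E)%E) ->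
  forall E, <<s G >> E -> P (E `&` D) = (P D * P E)%E.
Proof.
move=> Gm GI GT mD indep E sE.
have PD0 : 0 <= fine (P D) by exact: fine_ge0.
have PDE : P D = (fine (P D))%:E by rewrite fineK// fin_num_measure.
have PmE A : (P D * P A)%E = mscale (NngNum PD0) P A by rewrite /mscale/= -PDE.
rewrite PmE -[LHS]/(mrestr P mD E).
apply: (g_sigma_algebra_measure_unique G Gm (fun _ : nat => setT)
  (fun _ => GT) _ (mrestr P mD) (mscale (NngNum PD0) P)) => //.
- by rewrite bigcup_const//; exists 0%N.
- by move=> A GA /=; rewrite -PmE; exact: indep.
- by move=> _; rewrite /= /mrestr setTI ltey_eq fin_num_measure.
Qed.

(** Independence says that the law of [(X, Y)] is the product of the two laws.
Slicing [C] along [Y] makes the law of [X] appear on each slice, where it is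
the integral of [f]; Tonelli then exchanges the roles of the two variables.
[Y] ranges over an arbitrary measurable space so that it can be the identity
of [T], seen as a map onto a coarser sigma-algebra. *)
Lemma freezing_pdf (d d' : measure_display) (T : measurableType d)
    (T' : measurableType d') (R : realType) (P : probability T R)
    (X : {RV P >-> R}) (Y : {RV P >-> T'}) (f : R -> R) (C : set (R * T')) :
  is_pdf X f ->
  (forall A B, measurable A -> measurable B ->
     P (X @^-1` A `&` Y @^-1` B) = (P (X @^-1` A) * P (Y @^-1` B))%E) ->
  measurable C ->
  P [set w | C (X w, Y w)] =
  (\int[lebesgue_measure]_t ((f t)%:E * P [set w | C (t, Y w)]))%E.
Proof.
move=> [mf f0 Xf] indep mC.
pose XY w := (X w, Y w).
have mXY : measurable_fun setT XY by exact: measurable_fun_pair.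
pose Z : {mfun T >-> (R * T')%type} := mfun_Sub (mem_set mXY).
have -> : P [set w | C (X w, Y w)] = (distribution P X \x^ distribution P Y)%E C.
  transitivity (distribution P Z C) => //.
  transitivity ((distribution P X \x distribution P Y)%E C).
    by apply/esym; apply: product_measure_unique => // A B; exact: indep.
  by apply: product_measure_unique => // A B mA mB; exact: product_measure2E.
rewrite /product_measure2.
(* [h (t, y)] is the density of [X] cut off to the slice of [C] at [y] *)
pose h (z : R * T') : \bar R := ((f z.1)%:E * (\1_C z)%:E)%E.
have mh : measurable_fun [set: R * T'] h.
  apply: emeasurable_funM; apply/measurable_EFinP.
    exact: measurableT_comp.
  exact: measurable_indic.
have h0 z : (0 <= h z)%E by rewrite mule_ge0// lee_fin.
transitivity (\int[distribution P Y]_y \int[lebesgue_measure]_t h (t, y))%E.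
  apply: eq_integral => y _ /=.
  rewrite Xf; last exact: measurable_ysection.
  rewrite integral_mkcond; apply: eq_integral => t _.
  by rewrite patchE mem_ysection /h /= indicE; case: ifPn; rewrite ?mule1 ?mule0.
rewrite -fubini_tonelli//; apply: eq_integral => t _.
have -> : [set w | C (t, Y w)] = Y @^-1` xsection C t.
  by apply/seteqP; split => w /=; rewrite /xsection /= inE.
transitivity (\int[distribution P Y]_y
    ((f t)%:E * (\1_(xsection C t) y)%:E))%E.
  by apply: eq_integral => y _; rewrite /h /= !indicE mem_xsection.
have mCt : measurable (xsection C t) by exact: measurable_xsection.
rewrite ge0_integralZl ?lee_fin//; first by rewrite integral_indic ?setIT.
by apply/measurable_EFinP; exact: measurable_indic.
Qed.

(** * One lifetime compared with all the others *)

Lemma measurable_joint_event (d : measure_display) (T : measurableType d)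
    (R : realType) (n : nat) (j : 'I_n) (D : set R) (B : 'I_n -> set (R * R))
    (x : T -> R) (y : 'I_n -> T -> R) :
  measurable D -> (forall i, measurable (B i)) ->
  measurable_fun setT x -> (forall i, i != j -> measurable_fun setT (y i)) ->
  measurable [set w | D (x w) /\ forall i, i != j -> B i (x w, y i w)].
Proof.
move=> mD mB mx my.
rewrite (_ : [set w | _] = x @^-1` D `&`
  \bigcap_(i in [set i | i != j]) ((fun w => (x w, y i w)) @^-1` B i)) //.
apply: measurableI; first by rewrite -[X in measurable X]setTI; exact: mx.
apply: fin_bigcap_measurable => [|i /= ij]; first exact: finite_finset.
rewrite -[X in measurable X]setTI.
by apply: (measurable_fun_pair mx (my i ij)).
Qed.

(** Once the value [t] of [X j] is frozen, the remaining conditions bear on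
distinct independent variables, whence the product.  The condition [D] on [X j]
alone becomes the domain of integration. *)
Lemma joint_event_integral (d : measure_display) (T : measurableType d)
    (R : realType) (P : probability T R) (n : nat) (X : 'I_n -> {RV P >-> R})
    (j : 'I_n) (f : R -> R) (D : set R) (B : 'I_n -> set (R * R)) :
  mutually_independent X -> is_pdf (X j) f ->
  measurable D -> (forall i, measurable (B i)) ->
  P [set w | D (X j w) /\ forall i, i != j -> B i (X j w, X i w)] =
  (\int[lebesgue_measure]_(t in D)
     ((f t)%:E * \prod_(i | i != j) P [set w | B i (t, X i w)]))%E.
Proof.
move=> X_indep Xf mD mB.
(* the pi-system of events on the variables other than [X j] *)
pose cyl (A : 'I_n -> set R) := [set w | forall i, i != j -> A i (X i w)].
pose G := [set E | exists2 A, (forall i, measurable (A i)) & E = cyl A].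
have cylE A : cyl A = \bigcap_(i in [set` [set~ j]%SET]) (X i @^-1` A i).
  apply/seteqP; split => w /= Aw i => [|ij]; last by apply: Aw; rewrite /= !inE.
  by rewrite /= !inE; exact: Aw.
have mX i (A : set R) : measurable A -> measurable (X i @^-1` A).
  by move=> mA; rewrite -[X in measurable X]setTI; exact: measurable_funPT.
have mcyl A : (forall i, measurable (A i)) -> measurable (cyl A).
  move=> mA; rewrite cylE; apply: fin_bigcap_measurable => // i _; exact: mX.
have Pcyl A : (forall i, measurable (A i)) ->
    P (cyl A) = (\prod_(i | i != j) P (X i @^-1` A i))%E.
  move=> mA; rewrite cylE X_indep//.
  by apply: eq_bigl => i; rewrite !inE.
have GT : G setT.
  by exists (fun=> setT) => //; apply/seteqP; split.
have GI : setI_closed G.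
  move=> _ _ [A mA ->] [A' mA' ->].
  exists (fun i => A i `&` A' i); first by move=> i; exact: measurableI.
  apply/seteqP; split => w /=.
    by move=> [Aw A'w] i ij; split; [exact: Aw|exact: A'w].
  by move=> AA'w; split=> i /AA'w[].
have Gm : G `<=` measurable by move=> _ [A mA ->]; exact: mcyl.
have indepG A E : measurable A -> G E ->
    P (E `&` X j @^-1` A) = (P (X j @^-1` A) * P E)%E.
  move=> mA [A' mA' ->]; rewrite Pcyl//.
  (* one family of sets over all indices, with [A] put in at [j] *)
  pose A'' i := if i == j then A else A' i.
  have mA'' i : measurable (A'' i) by rewrite /A''; case: ifP.
  have -> : cyl A' `&` X j @^-1` A =
      \bigcap_(i in [set` [set: 'I_n]%SET]) (X i @^-1` A'' i).
    apply/seteqP; split => w /=.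
      move=> [A'w Aw] i _; rewrite /= /A''; case: eqVneq => [->//|]; exact: A'w.
    move=> A''w; split; last by have /= := A''w j; rewrite /A'' eqxx inE; exact.
    by move=> i ij; have /= := A''w i; rewrite /A'' (negbTE ij) inE; exact.
  rewrite X_indep// (bigD1 j) ?inE//= {1}/A'' eqxx; congr (_ * _)%E.
  by apply: eq_big => i; rewrite ?inE// /A'' => /negbTE ->.
have mid : measurable_fun [set: T] (idfun : T -> g_sigma_algebraType G).
  move=> _ A mA; rewrite setTI preimage_id.
  exact: (smallest_sub (@sigma_algebra_measurable _ T) Gm).
pose Y : {RV P >-> g_sigma_algebraType G} := mfun_Sub (mem_set mid).
have mXG i : i != j ->
    measurable_fun [set: g_sigma_algebraType G] (X i : _ -> R).
  move=> ij _ A mA; rewrite setTI; apply: sub_sigma_algebra.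
  exists (fun k => if k == i then A else setT); first by move=> k; case: ifP.
  apply/seteqP; split=> w /=.
    by move=> Aw k _; case: eqVneq => // ->.
  by move=> /(_ i ij); rewrite eqxx.
pose C : set (R * g_sigma_algebraType G) :=
  [set z | D z.1 /\ forall i, i != j -> B i (z.1, X i z.2)].
have mC : measurable C.
  apply: measurable_joint_event => // i ij.
  by apply: (measurableT_comp (mXG i ij)); exact: measurable_snd.
transitivity (P [set w | C (X j w, Y w)]) => //.
rewrite (freezing_pdf Xf _ mC); last first.
  move=> A E mA mE; rewrite setIC.
  by apply: (indep_sigma_algebra Gm GI GT) => //; [exact: mX|move=> ? /indepG ->].
rewrite [RHS]integral_mkcond; apply: eq_integral => t _; rewrite patchE.
case: ifPn => [/set_mem Dt|/negP Dt].
- have mBt i : measurable (xsection (B i) t) by exact: measurable_xsection.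
  congr (_ * _)%E.
  have -> : [set w | C (t, Y w)] = cyl (fun i => xsection (B i) t).
    apply/seteqP; split => w /=.
      by move=> [_ Bw] i /Bw; rewrite /xsection /= inE.
    by move=> Bw; split => // i /Bw; rewrite /xsection /= inE.
  rewrite Pcyl//; apply: eq_bigr => i _; congr (P _).
  by apply/seteqP; split => w /=; rewrite /xsection /= inE.
- have -> : [set w | C (t, Y w)] = set0.
    by apply/seteqP; split => w //= [] /= /mem_set.
  by rewrite measure0 mule0.
Qed.

(** * Distribution functions of laws with a density *)

Lemma pdf_atomless (d : measure_display) (T : measurableType d)
    (R : realType) (P : probability T R) (X : {RV P >-> R}) (f : R -> R) t :
  is_pdf X f -> P [set w | X w = t] = 0%E.
Proof.
move=> [_ _ Xf]; rewrite -[LHS]/(distribution P X [set t]) Xf//.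
exact: integral_set1.
Qed.

Lemma cdf_lt_eq (d : measure_display) (T : measurableType d)
    (R : realType) (P : probability T R) (X : {RV P >-> R}) t :
  cdf X t = (P [set w | (X w < t)%R] + P [set w | X w = t])%E.
Proof.
have mX (A : set R) : measurable A -> measurable (X @^-1` A).
  by move=> mA; rewrite -[X in measurable X]setTI; exact: measurable_funPT.
have mlt : measurable (X @^-1` `]-oo, t[) by exact: mX.
have -> : [set w | X w < t] = X @^-1` `]-oo, t[.
  by apply/seteqP; split => w /=; rewrite in_itv.
rewrite -measureU//; [|exact: (mX [set t])|].
  congr (P _); apply/seteqP; split => w /=; rewrite !in_itv/= le_eqVlt.
    by move=> /orP[/eqP|]; [right|left].
  by case=> [->|->]; rewrite ?orbT ?eqxx.
by apply/seteqP; split => w //= []; rewrite in_itv/= => /[swap] ->; rewrite ltxx.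
Qed.

Lemma pdf_prob_lt (d : measure_display) (T : measurableType d)
    (R : realType) (P : probability T R) (X : {RV P >-> R}) (f : R -> R) t :
  is_pdf X f -> P [set w | X w < t] = cdf X t.
Proof. by move=> Xf; rewrite cdf_lt_eq (pdf_atomless t Xf) adde0. Qed.

Lemma prob_gt (d : measure_display) (T : measurableType d)
    (R : realType) (P : probability T R) (X : {RV P >-> R}) t :
  P [set w | t < X w] = (1 - cdf X t)%E.
Proof.
rewrite /cdf -probability_setC//; congr (P _).
by apply/seteqP; split => w /=; rewrite in_itv/= ltNge => /negP.
Qed.

Lemma pdf_prob_ge (d : measure_display) (T : measurableType d)
    (R : realType) (P : probability T R) (X : {RV P >-> R}) (f : R -> R) t :
  is_pdf X f -> P [set w | t <= X w] = (1 - cdf X t)%E.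
Proof.
move=> Xf; rewrite -(pdf_prob_lt t Xf).
have -> : [set w | X w < t] = X @^-1` `]-oo, t[.
  by apply/seteqP; split => w /=; rewrite in_itv.
rewrite -[P (X @^-1` _)]/(distribution P X _) -probability_setC//; congr (P _).
by apply/seteqP; split => w /=; rewrite in_itv/= leNgt => /negP.
Qed.

(** * The first index that attains a minimum *)

Lemma bigmax_lt_bigmin (R : realType) (n : nat) (x : 'I_n -> R)
    (S : {set 'I_n}) :
  (\big[maxe/-oo]_(i in ~: S) (x i)%:E < \big[mine/+oo]_(j in S) (x j)%:E)%E <->
  forall i j, i \notin S -> j \in S -> x i < x j.
Proof.
split=> [/bigmax_ltP[_ xS] i j iS jS|xS].
  have := xS i; rewrite inE => /(_ iS)/bigmin_gtP[_ /(_ j jS)].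
  by rewrite lte_fin.
apply/bigmax_ltP; split=> [|i].
  by apply/bigmin_gtP; split => // j _; rewrite ltNyr.
rewrite inE => iS; apply/bigmin_gtP; split=> [|j jS]; first by rewrite ltry.
by rewrite lte_fin xS.
Qed.

(** Take the least index among those where [x] attains its minimum over [S]: an
index before it in [S] cannot attain the minimum, so there the inequality is
strict. *)
Lemma exists_first_argmin (R : realType) (n : nat) (x : 'I_n -> R)
    (S : {set 'I_n}) :
  S != finset.set0 ->
  exists2 j, j \in S & forall i, i \in S -> i != j ->
    if (i < j)%N then x j < x i else x j <= x i.
Proof.
case/set0Pn => j0 j0S.
have [j1 j1S j1min] := @Order.TotalTheory.arg_minP _ _ _ j0 (mem S) x j0S.
pose Q : pred 'I_n := [pred j | (j \in S) && (x j == x j1)].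
have Qj1 : Q j1 by rewrite /Q /= eqxx andbT; exact: j1S.
have [j /andP[jS /eqP xj] jmin] := arg_minnP (fun j : 'I_n => (j : nat)) Qj1.
exists j => // i iS ij; rewrite xj; case: ifP => ltij; last exact: j1min.
rewrite lt_neqAle j1min// andbT; apply/eqP => xi.
by have := jmin i; rewrite /Q /= iS xi eqxx leqNgt ltij => /(_ isT).
Qed.

(** With [j] in [S] and [z] the values at [j] and [i], this holds for all [i]
other than [j] if and only if [j] is the first index in [S] at which the minimum over [S] is
attained and all values outside [S] are below that minimum; the strict
inequality for the indices before [j] is what breaks ties. *)
Definition precedes (R : realType) (n : nat) (S : {set 'I_n}) (j i : 'I_n) :
    set (R * R) :=
  [set z | if i \in S then (if (i < j)%N then z.1 < z.2 else z.1 <= z.2)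
           else z.2 < z.1].

Lemma measurable_precedes (R : realType) (n : nat) (S : {set 'I_n})
    (j i : 'I_n) : measurable (precedes (R := R) S j i).
Proof.
have pre (r : R * R -> bool) : measurable_fun setT r -> measurable [set z | r z].
  by move=> mr; have := mr measurableT [set true] I; rewrite setTI.
have [m1 m2] := (@measurable_fst _ _ R R, @measurable_snd _ _ R R).
have m12 := pre _ (measurable_fun_ltr m1 m2).
have m21 := pre _ (measurable_fun_ltr m2 m1).
have m12' := pre _ (measurable_fun_ler m1 m2).
by rewrite /precedes; case: (i \in S); first case: (i < j)%N.
Qed.

(** The separation event is cut by the first index of [S] at which the minimum
over [S] is attained.  The interval in each piece costs nothing for nonnegative
variables, and yields the domain of integration. *)
Lemma separated_eq_bigcup (R : realType) (n : nat) (W : Type)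
    (X : 'I_n -> W -> R) (S : {set 'I_n}) :
  S != finset.set0 -> (forall i w, 0 <= X i w) ->
  [set w | forall i j, i \notin S -> j \in S -> X i w < X j w] =
  \bigcup_(j in [set` S])
    [set w | `[0, +oo[%classic (X j w) /\
             forall i, i != j -> precedes S j i (X j w, X i w)].
Proof.
move=> S_neq0 X_ge0; apply/seteqP; split=> w /=.
- move=> sepw; have [j jS jmin] := exists_first_argmin (X ^~ w) S_neq0.
  exists j => //=; split=> [|i ij]; first by rewrite in_itv/= X_ge0.
  rewrite /precedes /=; case: ifPn => iS; last exact: sepw.
  exact: jmin.
- move=> [k kS [_ kmin]] i j iS jS.
  have ik : i != k by apply: contraNneq iS => ->.
  have := kmin i ik; rewrite /precedes /= (negbTE iS) => /lt_le_trans; apply.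
  have [->//|jk] := eqVneq j k.
  by have := kmin j jk; rewrite /precedes /= jS; case: ifP => _ // /ltW.
Qed.

(** Two indices [j < k] of [S] cannot both be first: being first, [k] would need
a value strictly below that of [j], and [j] a value at most that of [k]. *)
Lemma trivIset_first_argmin (R : realType) (n : nat) (W : Type)
    (X : 'I_n -> W -> R) (S : {set 'I_n}) (D : 'I_n -> set W) :
  trivIset [set` S]
    (fun j => [set w | D j w /\
       forall i, i != j -> precedes S j i (X j w, X i w)]).
Proof.
suff noboth j k w : j \in S -> k \in S -> (j < k)%N ->
    (forall i, i != j -> precedes S j i (X j w, X i w)) ->
    (forall i, i != k -> precedes S k i (X k w, X i w)) -> False.
  move=> j k jS kS [w [[_ wj] [_ wk]]]; apply/val_inj/eqP => /=.
  rewrite eqn_leq; apply/andP; split; rewrite leqNgt; apply/negP => lt.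
    exact: (noboth k j w).
  exact: (noboth j k w).
move=> jS kS ltjk wj wk.
have kj : k != j by apply: contraTneq ltjk => ->; rewrite ltnn.
have := wj k kj; have := wk j; rewrite eq_sym kj => /(_ isT).
rewrite /precedes /= jS kS ltjk ltnNge (ltnW ltjk) /= => lt le.
by have := lt_le_trans lt le; rewrite ltxx.
Qed.

(** * The relative quality function *)

Theorem proposition3 (d : measure_display) (T : measurableType d)
    (R : realType) (P : probability T R) (n : nat)
    (X : 'I_n -> {RV P >-> R}) (f F : 'I_n -> R -> R)
    (X_ge0 : forall i w, 0 <= X i w)
    (X_indep : mutually_independent X)
    (X_pdf : forall i, is_pdf (X i) (f i))
    (X_cdf : forall i t, cdf (X i) t = (F i t)%:E)
    (F0 : forall i, F i 0 = 0)
    (S : {set 'I_n}) (S_neq0 : S != finset.set0) :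
  (relative_quality X S)%:E =
  (\sum_(j in S) \int[lebesgue_measure]_(t in `[0%R, +oo[)
     (f j t * \prod_(i in ~: S) F i t * \prod_(i in S :\ j) (1 - F i t))%:E)%E.
Proof.
have mfirst j : measurable [set w | `[0, +oo[%classic (X j w) /\
    forall i, i != j -> precedes S j i (X j w, X i w)].
  by apply: measurable_joint_event => // i; exact: measurable_precedes.
pose sep := [set w | forall i j, i \notin S -> j \in S -> X i w < X j w].
have -> : (relative_quality X S)%:E = P sep.
  (* for [S] the full set the separation condition is void, in agreement with
     the conventional value 1 *)
  rewrite /relative_quality (negbTE S_neq0) /=; case: eqP => [ST|_].
    rewrite [sep](_ : _ = setT) ?probability_setT//.
    by apply/seteqP; split => // w _ i j; rewrite ST inE.
  rewrite (_ : [set w | _] = sep); last first.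
    by apply/seteqP; split => w /bigmax_lt_bigmin.
  rewrite fineK// fin_num_measure// /sep separated_eq_bigcup//.
  apply: fin_bigcup_measurable => [|j jS]; first exact: finite_finset.
  exact: mfirst.
rewrite /sep separated_eq_bigcup// bigcup_pred.
rewrite measure_bigsetU_ord_cond; last 2 first.
- by move=> j jS; exact: mfirst.
- exact: trivIset_first_argmin.
apply: eq_bigr => j jS.
apply: etrans (joint_event_integral X_indep (X_pdf j) (measurable_itv `[0, +oo[)
  (measurable_precedes S j)) _.
apply: eq_integral => t _.
have Pprec i : P [set w | precedes S j i (t, X i w)] =
    (if i \in S then 1 - F i t else F i t)%:E.
  rewrite /precedes /=; case: (i \in S); last first.
    by rewrite (pdf_prob_lt t (X_pdf i)) X_cdf.
  rewrite EFinB -X_cdf; case: (i < j)%N; first by rewrite prob_gt.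
  by rewrite (pdf_prob_ge t (X_pdf i)).
rewrite (eq_bigr _ (fun i _ => Pprec i)) prodEFin -EFinM -mulrA.
congr (_ * _)%:E.
rewrite (bigID (mem S)) /= mulrC; congr (_ * _).
  apply: eq_big => i; first by rewrite inE andb_idl//; apply: contraNneq => ->.
  by move=> /andP[_ /negbTE ->].
by apply: eq_big => i; rewrite ?inE// => /andP[_ ->].
Qed.
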